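(* For all formulas $\varphi,\psi\in\mathcal{LQ}$, $\varphi\vdash_\mathsf{FQ}\psi$ if and only if $\varphi\vDash_\mathbb{PRQ}\psi$.
   Context: $\mathcal{LQ}$ is the first-order language without function symbols, constants or identity, over a countably infinite set $\mathsf{Var}$ of variables: $\varphi::= P(v_1,\dots,v_n)\mid\neg\varphi\mid(\varphi\wedge\varphi)\mid(\varphi\vee\varphi)\mid\forall v\varphi\mid\exists v\varphi$. $\varphi^v_u$ is the result of substituting $u$ for free $v$ in $\varphi$. Proofs for $\vdash_\mathsf{FQ}$: finite sequences whose first entry is a formula and whose later entries are formulas or proofs; the set of proofs is the smallest set containing $\langle\varphi\rangle$ for each formula and closed under, for a proof $\langle\sigma_1,\dots,\sigma_n\rangle$ and $1\le i,j\le n$: appending any proof $\tau$; ($\wedge$I) appending $\sigma_i\wedge\sigma_j$ for formulas $\sigma_i,\sigma_j$; ($\wedge$E) if $\sigma_i=\varphi\wedge\psi$, appending $\varphi$ or $\psi$; ($\vee$I) if $\sigma_i$ is a formula, appending $\sigma_i\vee\varphi$ or $\varphi\vee\sigma_i$; ($\vee$E) if $\sigma_i=\varphi\vee\psi$, $\sigma_{n-1}$ is a sequence beginning with $\varphi$ and ending with $\chi$, $\sigma_n$ is a sequence beginning with $\psi$ and ending with $\chi$, appending $\chi$; ($\neg$I) if $\sigma_i$ is a formula $\psi$ and $\sigma_n$ is a sequence beginning with $\varphi$ and ending with $\neg\psi$, appending $\neg\varphi$; ($\neg$E) if $\sigma_i=\varphi$ and $\sigma_j=\neg\varphi$, appending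 any $\psi$; ($\forall$I) if $\sigma_i$ is a formula $\varphi$ and $v$ does not occur free in $\sigma_1$, appending $\forall v\varphi$; ($\forall$E) if $\sigma_i=\forall v\varphi$ and $u$ is substitutable for $v$ in $\varphi$, appending $\varphi^v_u$; ($\exists$I) if $\sigma_i=\varphi^v_u$ with $u$ substitutable for $v$ in $\varphi$, appending $\exists v\varphi$; ($\exists$E) if $\sigma_i=\exists v\varphi$, $\sigma_n$ is a proof beginning with $\varphi$ and ending with $\psi$, and $v$ is not free in $\psi$, appending $\psi$. $\varphi\vdash_\mathsf{FQ}\psi$ iff some proof has first entry $\varphi$ and last entry $\psi$. Semantics: a frame for $\mathcal{LQ}$ is $(X,\vartriangleleft,D)$ with $X$ nonempty, $\vartriangleleft\subseteq X\times X$ (write $y\vartriangleright x$ for $x\vartriangleleft y$), and $D$ a nonempty set disjoint from $X$. $c_\vartriangleleft(A)=\{x\mid\forall x'\vartriangleleft x\ \exists x''\vartriangleright x':x''\in A\}$. A model adds $V$ assigning to each $n$-ary predicate $P$ and $d_1,\dots,d_n\in D$ a set $V(P,d_1,\dots,d_n)$ with $c_\vartriangleleft(V(P,\vec d))=V(P,\vec d)$. For assignments $g\in D^\mathsf{Var}$ ($h\sim_v g$ means $h,g$ differ at most at $v$): $x\Vdash_g P(v_1,\dots,v_n)$ iff $x\in V(P,g(v_1),\dots,g(v_n))$; $x\Vdash_g\neg\varphi$ iff $\forall x'\vartriangleleft x$, $x'\nVdash_g\varphi$; $x\Vdash_g\varphi\wedge\psi$ iff both; $x\Vdash_g\varphi\vee\psi$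 iff $\forall x'\vartriangleleft x\ \exists x''\vartriangleright x'$: $x''\Vdash_g\varphi$ or $x''\Vdash_g\psi$; $x\Vdash_g\forall v\varphi$ iff $\forall h\sim_v g$, $x\Vdash_h\varphi$; $x\Vdash_g\exists v\varphi$ iff $\forall x'\vartriangleleft x\ \exists x''\vartriangleright x'\ \exists h\sim_v g$: $x''\Vdash_h\varphi$. $x$ pre-refines $y$ if $z\vartriangleleft x$ implies $z\vartriangleleft y$ for all $z$. $\mathbb{PRQ}$ is the class of frames $(X,\vartriangleleft,D)$ with $\vartriangleleft$ reflexive and pseudosymmetric (for all $x$ and $y\vartriangleleft x$ there is $z\vartriangleleft y$ pre-refining $x$). $\varphi\vDash_\mathbb{PRQ}\psi$ iff for every model on a frame in $\mathbb{PRQ}$, every assignment $g$, and every $x$, $x\Vdash_g\varphi$ implies $x\Vdash_g\psi$. *)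

(* Defs.v *)
From mathcomp Require Import all_boot.
From Stdlib Require List.

Set Implicit Arguments.
Unset Strict Implicit.
Unset Printing Implicit Defensive.

Record signature := Signature { predicate : Type; arity : predicate -> nat }.

Definition var := nat.

Inductive formula (S : signature) : Type :=
| Atom (P : predicate S) (vs : (arity P).-tuple var)
| Neg (phi : formula S)
| And (phi psi : formula S)
| Or (phi psi : formula S)
| All (v : var) (phi : formula S)
| Ex (v : var) (phi : formula S).

Section Syntax.
Variable S : signature.
Implicit Types (phi psi chi : formula S) (u v w : var).

Fixpoint free v phi : bool :=
  match phi with
  | Atom _ vs => v \in vs
  | Neg phi => free v phi
  | And phi psi | Or phi psi => free v phi || free v psi
  | All w phi | Ex w phi => (v != w) && free v phi
  end.

Definition subst_var v u w : var := if w == v then u else w.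

(* [subst v u phi] replaces the free occurrences of [v] by [u]; bound variables
   are not renamed, so it is meaningful only under [substitutable v u phi]. *)
Fixpoint subst v u phi : formula S :=
  match phi with
  | Atom P vs => Atom (map_tuple (subst_var v u) vs)
  | Neg phi => Neg (subst v u phi)
  | And phi psi => And (subst v u phi) (subst v u psi)
  | Or phi psi => Or (subst v u phi) (subst v u psi)
  | All w phi => if w == v then All w phi else All w (subst v u phi)
  | Ex w phi => if w == v then Ex w phi else Ex w (subst v u phi)
  end.

(* No free occurrence of [v] in [phi] lies in the scope of a quantifier
   binding [u]; in particular [v] is substitutable for itself. *)
Fixpoint substitutable v u phi : bool :=
  match phi with
  | Atom _ _ => true
  | Neg phi => substitutable v u phi
  | And phi psi | Or phi psi => substitutable v u phi && substitutable v u psi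
  | All w phi | Ex w phi =>
      ~~ ((v != w) && free v phi) || (w != u) && substitutable v u phi
  end.

(* Raw entries and raw sequences of entries; [proof] carves out the proofs. *)
Inductive entry : Type :=
| Fm (phi : formula S)
| Sub (t : seq entry).

Definition occurs (e : entry) (s : seq entry) : Prop := List.In e s.
Definition begins_with (s : seq entry) phi : Prop :=
  exists r, s = Fm phi :: r.
Definition ends_with (s : seq entry) phi : Prop :=
  exists r, s = rcons r (Fm phi).
Definition last_entry (s : seq entry) (e : entry) : Prop :=
  exists r, s = rcons r e.
Definition last_two_entries (s : seq entry) (e1 e2 : entry) : Prop :=
  exists r, s = rcons (rcons r e1) e2.

Inductive proof : seq entry -> Prop :=
| proof_start phi : proof [:: Fm phi]
| proof_sub s t : proof s -> proof t -> proof (rcons s (Sub t))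
| proof_andI s phi psi :
    proof s -> occurs (Fm phi) s -> occurs (Fm psi) s ->
    proof (rcons s (Fm (And phi psi)))
| proof_andEl s phi psi :
    proof s -> occurs (Fm (And phi psi)) s -> proof (rcons s (Fm phi))
| proof_andEr s phi psi :
    proof s -> occurs (Fm (And phi psi)) s -> proof (rcons s (Fm psi))
| proof_orIl s phi psi :
    proof s -> occurs (Fm phi) s -> proof (rcons s (Fm (Or phi psi)))
| proof_orIr s phi psi :
    proof s -> occurs (Fm psi) s -> proof (rcons s (Fm (Or phi psi)))
| proof_orE s t1 t2 phi psi chi :
    proof s -> occurs (Fm (Or phi psi)) s ->
    last_two_entries s (Sub t1) (Sub t2) ->
    begins_with t1 phi -> ends_with t1 chi ->
    begins_with t2 psi -> ends_with t2 chi ->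
    proof (rcons s (Fm chi))
| proof_negI s t phi psi :
    proof s -> occurs (Fm psi) s ->
    last_entry s (Sub t) -> begins_with t phi -> ends_with t (Neg psi) ->
    proof (rcons s (Fm (Neg phi)))
| proof_negE s phi psi :
    proof s -> occurs (Fm phi) s -> occurs (Fm (Neg phi)) s ->
    proof (rcons s (Fm psi))
| proof_allI s alpha phi v :
    proof s -> occurs (Fm phi) s ->
    begins_with s alpha -> ~~ free v alpha ->
    proof (rcons s (Fm (All v phi)))
| proof_allE s phi v u :
    proof s -> occurs (Fm (All v phi)) s -> substitutable v u phi ->
    proof (rcons s (Fm (subst v u phi)))
| proof_exI s phi v u :
    proof s -> substitutable v u phi -> occurs (Fm (subst v u phi)) s ->
    proof (rcons s (Fm (Ex v phi)))
| proof_exE s t phi psi v :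
    proof s -> occurs (Fm (Ex v phi)) s ->
    last_entry s (Sub t) -> begins_with t phi -> ends_with t psi ->
    ~~ free v psi ->
    proof (rcons s (Fm psi)).

Definition FQ_derives phi psi : Prop :=
  exists s, [/\ proof s, begins_with s phi & ends_with s psi].

End Syntax.

(* Points and individuals live in separate types, hence are disjoint. *)
Record frame := Frame {
  point : Type;
  open_to : point -> point -> Prop;
  individual : Type;
  point_inhabited : inhabited point;
  individual_inhabited : inhabited individual }.

Section Semantics.
Variable F : frame.
Implicit Types x y z : point F.

Local Notation "x <| y" := (open_to x y) (at level 70).

Definition closure (A : point F -> Prop) x : Prop :=
  forall x', x' <| x -> exists x'', x' <| x'' /\ A x''.

Definition pre_refines x y : Prop := forall z, z <| x -> z <| y.

Definition reflexive_frame : Prop := forall x, x <| x.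

Definition pseudosymmetric_frame : Prop :=
  forall x y, y <| x -> exists z, z <| y /\ pre_refines z x.

Definition PRQ : Prop := reflexive_frame /\ pseudosymmetric_frame.

Record model (S : signature) := Model {
  val_atom : forall P : predicate S,
    (arity P).-tuple (individual F) -> point F -> Prop;
  val_atom_closed : forall (P : predicate S) (d : (arity P).-tuple (individual F)) x,
    closure (val_atom d) x <-> val_atom d x }.

Definition assignment := var -> individual F.

Definition variant (v : var) (h g : assignment) : Prop :=
  forall w, w <> v -> h w = g w.

Fixpoint forces (S : signature) (M : model S) (g : assignment)
    (phi : formula S) x : Prop :=
  match phi with
  | Atom P vs => val_atom M (map_tuple g vs) x
  | Neg phi => forall x', x' <| x -> ~ forces M g phi x'
  | And phi psi => forces M g phi x /\ forces M g psi x
  | Or phi psi =>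
      forall x', x' <| x ->
      exists x'', x' <| x'' /\ (forces M g phi x'' \/ forces M g psi x'')
  | All v phi => forall h, variant v h g -> forces M h phi x
  | Ex v phi =>
      forall x', x' <| x ->
      exists x'', x' <| x'' /\ exists h, variant v h g /\ forces M h phi x''
  end.

End Semantics.

Definition PRQ_entails (S : signature) (phi psi : formula S) : Prop :=
  forall (F : frame), PRQ F ->
  forall (M : model F S) (g : assignment F) (x : point F),
  forces M g phi x -> forces M g psi x.

(* Main.v *)
(** Completeness uses a canonical model built directly from derivability. Its
    points are the pairs (a, b) of formulas such that a does not derive b while
    ~a derives b, with (a, b) open to (c, d) when c does not derive b; its
    individuals are the variables. Since FQ derives [forall v phi] (resp.
    [exists v phi]) as the infimum (resp. supremum) of all the instances of
    [phi], fresh variables witnessing it, (a, b) forces phi under g exactly when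
    a derives phi with g substituted for its free variables. If phi does not
    derive psi, then (phi, ~phi) is a point refuting the entailment. *)
From mathcomp Require Import all_boot.
From Stdlib Require Import Classical.
Require Import Defs.

Set Implicit Arguments.
Unset Strict Implicit.
Unset Printing Implicit Defensive.

(** * Syntax *)

Section Alpha.
Variable S : signature.
Implicit Types (phi psi chi : formula S) (u v w : var).

Definition update (D : Type) (g : var -> D) (v : var) (d : D) : var -> D :=
  fun w => if w == v then d else g w.

Lemma not_free_substitutable v u phi : ~~ free v phi -> substitutable v u phi.
Proof.
elim: phi => //= [phi IH1 psi IH2|phi IH1 psi IH2|w phi _ ->//|w phi _ ->//];
  by rewrite negb_or => /andP[/IH1-> /IH2].
Qed.

Lemma subst_not_free v u phi : ~~ free v phi -> subst v u phi = phi.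
Proof.
elim: phi => /= [P vs|phi IH|phi IH1 psi IH2|phi IH1 psi IH2|w phi IH|w phi IH].
- move=> nv; congr Atom; apply: val_inj => /=.
  rewrite -[RHS]map_id; apply/eq_in_map => w wvs; rewrite /subst_var.
  by case: eqP => // wv; rewrite -wv wvs in nv.
- by move/IH->.
- by rewrite negb_or => /andP[/IH1-> /IH2->].
- by rewrite negb_or => /andP[/IH1-> /IH2->].
- by rewrite eq_sym; case: eqVneq => //= _ /IH->.
- by rewrite eq_sym; case: eqVneq => //= _ /IH->.
Qed.

(** Binders count as well as free variables, so a variable at or above the bound is neither free in
    the formula nor captured when substituted into it. *)
Fixpoint var_bound phi : nat :=
  match phi with
  | Atom _ vs => \max_(v <- vs) v.+1
  | Neg phi => var_bound phi
  | And phi psi | Or phi psi => maxn (var_bound phi) (var_bound psi)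
  | All v phi | Ex v phi => maxn v.+1 (var_bound phi)
  end.

Lemma free_var_bound v phi : free v phi -> v < var_bound phi.
Proof.
elim: phi => //= [P vs|phi IH1 psi IH2|phi IH1 psi IH2|w phi IH|w phi IH].
- by move=> vvs; exact: (@leq_bigmax_seq nat vs xpredT succn).
- by case/orP=> [/IH1|/IH2]; rewrite leq_max => ->; rewrite ?orbT.
- by case/orP=> [/IH1|/IH2]; rewrite leq_max => ->; rewrite ?orbT.
- by case/andP=> _ /IH; rewrite leq_max => ->; rewrite orbT.
- by case/andP=> _ /IH; rewrite leq_max => ->; rewrite orbT.
Qed.

Lemma not_free_var_bound v phi : var_bound phi <= v -> ~~ free v phi.
Proof. by rewrite leqNgt; apply: contra; exact: free_var_bound. Qed.

Lemma var_bound_substitutable v u phi :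
  var_bound phi <= u -> substitutable v u phi.
Proof.
elim: phi => //= [phi IH1 psi IH2|phi IH1 psi IH2|w phi IH|w phi IH];
  rewrite geq_max => /andP[].
- by move=> /IH1-> /IH2.
- by move=> /IH1-> /IH2.
- by move=> wu /IH->; rewrite (neq_ltn _ u) wu orbT.
- by move=> wu /IH->; rewrite (neq_ltn _ u) wu orbT.
Qed.

Lemma not_free_subst v u phi : v != u -> ~~ free v (subst v u phi).
Proof.
move=> vu; elim: phi => /= [P vs|phi IH|phi IH1 psi IH2|phi IH1 psi IH2|w phi IH|w phi IH].
- apply/mapP => -[w _]; rewrite /subst_var.
  by case: eqVneq => [_|/eqP wv /esym//]; apply/eqP.
- exact: IH.
- by rewrite negb_or IH1.
- by rewrite negb_or IH1.
- by case: (eqVneq w v) => [->|_] /=; rewrite ?eqxx // (negbTE IH) andbF.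
- by case: (eqVneq w v) => [->|_] /=; rewrite ?eqxx // (negbTE IH) andbF.
Qed.

(** As [u] lies above every variable of [phi], its occurrences after the substitution are exactly
    the former free ones of [v], none of them under a binder of [v]. A fresh substitution can thus
    be undone. *)
Lemma subst_fresh_inv v u phi : var_bound phi <= u ->
  substitutable u v (subst v u phi) /\ subst u v (subst v u phi) = phi.
Proof.
elim: phi => /= [P vs|phi IH|phi IH1 psi IH2|phi IH1 psi IH2|w phi IH|w phi IH].
- move=> le; split=> //; congr Atom; apply: val_inj => /=.
  rewrite -map_comp -[RHS]map_id; apply/eq_in_map => w wvs /=.
  rewrite /subst_var; have [->|_] := eqVneq w v; first by rewrite eqxx.
  have [wu|//] := eqVneq w u; have := leq_trans (@leq_bigmax_seq nat vs xpredT succn _ wvs isT) le.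
  by rewrite wu ltnn.
- by move/IH=> [-> ->].
- by rewrite geq_max => /andP[/IH1[-> ->] /IH2[-> ->]].
- by rewrite geq_max => /andP[/IH1[-> ->] /IH2[-> ->]].
- rewrite geq_max => /andP[wu bu]; have [sb eb] := IH bu.
  have nwu : (w == u) = false by apply/negbTE; rewrite neq_ltn wu.
  have fu := not_free_var_bound bu.
  have [wv|wv] := eqVneq w v => /=.
    by rewrite nwu (negbTE fu) andbF subst_not_free.
  by rewrite nwu wv sb eb orbT.
- rewrite geq_max => /andP[wu bu]; have [sb eb] := IH bu.
  have nwu : (w == u) = false by apply/negbTE; rewrite neq_ltn wu.
  have fu := not_free_var_bound bu.
  have [wv|wv] := eqVneq w v => /=.
    by rewrite nwu (negbTE fu) andbF subst_not_free.
  by rewrite nwu wv sb eb orbT.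
Qed.

(** * Height and alpha-equivalence *)

Fixpoint height phi : nat :=
  match phi with
  | Atom _ _ => 0
  | Neg phi | All _ phi | Ex _ phi => (height phi).+1
  | And phi psi | Or phi psi => (maxn (height phi) (height psi)).+1
  end.

Lemma height_subst v u phi : height (subst v u phi) = height phi.
Proof.
by elim: phi => //= [phi->|phi-> psi->|phi-> psi->|w phi|w phi] //; case: eqP => //= _ ->.
Qed.

(* Equality of [phi] under [g] and [psi] under [h] up to the names of bound
   variables: it is read off in an arbitrary domain [D], so that [D] may be
   either the variables themselves or the individuals of a frame. *)
Fixpoint alpha (D : Type) (g : var -> D) phi (h : var -> D) psi {struct phi} : Prop :=
  match phi, psi with
  | Atom P vs, Atom Q ws =>
      existT (fun P => (arity P).-tuple D) P (map_tuple g vs) =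
      existT (fun P => (arity P).-tuple D) Q (map_tuple h ws)
  | Neg phi, Neg psi => alpha g phi h psi
  | And phi1 phi2, And psi1 psi2 | Or phi1 phi2, Or psi1 psi2 =>
      alpha g phi1 h psi1 /\ alpha g phi2 h psi2
  | All v phi, All w psi | Ex v phi, Ex w psi =>
      forall d, alpha (update g v d) phi (update h w d) psi
  | _, _ => False
  end.

Section AlphaTheory.
Variable D : Type.
Implicit Types (g h k : var -> D).

Lemma alpha_refl g h phi :
  (forall v, free v phi -> g v = h v) -> alpha g phi h phi.
Proof.
elim: phi g h => /= [P vs|phi IH|phi IH1 psi IH2|phi IH1 psi IH2|v phi IH|v phi IH] g h gh.
- by congr existT; apply: val_inj; apply/eq_in_map.
- exact: IH.
- by split; [apply: IH1|apply: IH2] => v fv; apply: gh; rewrite fv ?orbT.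
- by split; [apply: IH1|apply: IH2] => v fv; apply: gh; rewrite fv ?orbT.
- move=> d; apply: IH => w fw; rewrite /update; case: eqVneq => // wv.
  by apply: gh; rewrite wv.
- move=> d; apply: IH => w fw; rewrite /update; case: eqVneq => // wv.
  by apply: gh; rewrite wv.
Qed.

Lemma alpha_sym g h phi psi : alpha g phi h psi -> alpha h psi g phi.
Proof.
elim: phi psi g h => [P vs|phi IH|phi1 IH1 phi2 IH2|phi1 IH1 phi2 IH2|v phi IH|v phi IH]
  [Q ws|psi|psi1 psi2|psi1 psi2|w psi|w psi] g h //=.
- exact: IH.
- by case=> [/IH1 ? /IH2].
- by case=> [/IH1 ? /IH2].
- by move=> a d; apply: IH.
- by move=> a d; apply: IH.
Qed.

Lemma alpha_trans g h k phi psi chi :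
  alpha g phi h psi -> alpha h psi k chi -> alpha g phi k chi.
Proof.
elim: phi psi chi g h k =>
  [P vs|phi IH|phi1 IH1 phi2 IH2|phi1 IH1 phi2 IH2|v phi IH|v phi IH]
  [Q ws|psi|psi1 psi2|psi1 psi2|w psi|w psi] //
  [Q' ws'|chi|chi1 chi2|chi1 chi2|w' chi|w' chi] //= g h k.
- by move=> ->.
- exact: IH.
- by case=> a1 a2 [b1 b2]; split; [apply: IH1 a1 b1|apply: IH2 a2 b2].
- by case=> a1 a2 [b1 b2]; split; [apply: IH1 a1 b1|apply: IH2 a2 b2].
- by move=> a b d; apply: IH (a d) (b d).
- by move=> a b d; apply: IH (a d) (b d).
Qed.

Lemma alpha_height g phi h psi : alpha g phi h psi -> height phi = height psi.
Proof.
elim: phi psi g h => [P vs|phi IH|phi1 IH1 phi2 IH2|phi1 IH1 phi2 IH2|v phi IH|v phi IH]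
  [Q ws|psi|psi1 psi2|psi1 psi2|w psi|w psi] g h //=.
- by move/IH->.
- by case=> /IH1-> /IH2->.
- by case=> /IH1-> /IH2->.
(* Any individual would do here; [g v] is one that is certain to exist. *)
- by move=> /(_ (g v))/IH->.
- by move=> /(_ (g v))/IH->.
Qed.

(** The two sides could disagree only at [v], and only when [u] is [w], which substitutability
    excludes as soon as [v] is free in [phi]. *)
Lemma update_substitutable v u w phi g d z :
  w != v -> substitutable v u (All w phi) -> free z phi ->
  update (update g w d) v (update g w d u) z =
  update (update g v (g u)) w d z.
Proof.
move=> wv /= sub fz; rewrite /update.
case: (eqVneq z v) => // zv; rewrite -zv in wv sub *.
rewrite (eq_sym z) (negbTE wv).
by move: sub; rewrite fz (eq_sym z) wv /= eq_sym => /andP[/negbTE->].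
Qed.

(** The substitution lemma, phrased through [alpha] so that one proof serves both models, with [D]
    the individuals, and derivations, with [D] the variables. *)
Lemma alpha_subst v u g phi : substitutable v u phi ->
  alpha g (subst v u phi) (update g v (g u)) phi.
Proof.
elim: phi g => [P vs|phi IH|phi IH1 psi IH2|phi IH1 psi IH2|w phi IH|w phi IH] g sub.
- rewrite /=; congr existT; apply: val_inj => /=; rewrite -map_comp.
  by apply: eq_map => w /=; rewrite /subst_var /update; case: eqP.
- exact: IH.
- by case/andP: sub => s1 s2; split; [apply: IH1|apply: IH2].
- by case/andP: sub => s1 s2; split; [apply: IH1|apply: IH2].
- rewrite /=; case: (eqVneq w v) => [->|wv].
    by apply: alpha_refl => z /= /andP[/negbTE zv _]; rewrite /update zv.
  move=> d; apply: (alpha_trans (IH _ _)); last first.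
    by apply: alpha_refl => z; apply: update_substitutable.
  move: sub => /=; rewrite eq_sym wv /=.
  by case/orP=> [/not_free_substitutable|/andP[_]].
- rewrite /=; case: (eqVneq w v) => [->|wv].
    by apply: alpha_refl => z /= /andP[/negbTE zv _]; rewrite /update zv.
  move=> d; apply: (alpha_trans (IH _ _)); last first.
    by apply: alpha_refl => z; apply: update_substitutable.
  move: sub => /=; rewrite eq_sym wv /=.
  by case/orP=> [/not_free_substitutable|/andP[_]].
Qed.

End AlphaTheory.

(** * Capture-avoiding simultaneous substitution *)

Definition fresh (N : nat) (g : var -> var) phi : var :=
  (maxn N (\max_(v < var_bound phi) g v)).+1.

Lemma fresh_gt N g phi : N < fresh N g phi.
Proof. by rewrite ltnS leq_maxl. Qed.

Lemma fresh_free N g phi v : free v phi -> g v < fresh N g phi.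
Proof.
move=> /free_var_bound lt; rewrite ltnS leq_max; apply/orP; right.
exact: (leq_bigmax (Ordinal lt)).
Qed.

(* Simultaneous substitution of [g] for the free variables; the bound ones are
   renamed to variables greater than [N], to avoid captures. *)
Fixpoint rename (N : nat) (g : var -> var) phi : formula S :=
  match phi with
  | Atom P vs => Atom (map_tuple g vs)
  | Neg phi => Neg (rename N g phi)
  | And phi psi => And (rename N g phi) (rename N g psi)
  | Or phi psi => Or (rename N g phi) (rename N g psi)
  | All v phi => All (fresh N g phi) (rename N (update g v (fresh N g phi)) phi)
  | Ex v phi => Ex (fresh N g phi) (rename N (update g v (fresh N g phi)) phi)
  end.

(** Every binder of the renamed formula exceeds [N], so none of them is [u]. *)
Lemma substitutable_rename N g w u phi : u <= N -> substitutable w u (rename N g phi).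
Proof.
move=> uN; elim: phi g => //= [phi IH1 psi IH2|phi IH1 psi IH2|v phi IH|v phi IH] g.
- by rewrite IH1 IH2.
- by rewrite IH1 IH2.
- by rewrite IH (neq_ltn _ u) (leq_ltn_trans uN (fresh_gt N g phi)) !orbT.
- by rewrite IH (neq_ltn _ u) (leq_ltn_trans uN (fresh_gt N g phi)) !orbT.
Qed.

(** The conclusion of [alpha_rename] at [phi] is a premise, so that this step can be used inside the
    induction proving [alpha_rename]. *)
Lemma alpha_rename_update (D : Type) (h : var -> D) N (g : var -> var) v w d phi :
  (forall z, free z phi -> g z != w) ->
  (forall h' : var -> D, alpha h' (rename N (update g v w) phi) (h' \o update g v w) phi) ->
  alpha (update h w d) (rename N (update g v w) phi) (update (h \o g) v d) phi.
Proof.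
move=> gw IH; apply: alpha_trans (IH _) _; apply: alpha_refl => z fz /=.
rewrite /update; case: (eqVneq z v) => _; first by rewrite eqxx.
by rewrite (negbTE (gw z fz)).
Qed.

Lemma alpha_rename (D : Type) (h : var -> D) N (g : var -> var) phi :
  alpha h (rename N g phi) (h \o g) phi.
Proof.
elim: phi g h => //= [P vs|v phi IH|v phi IH] g h.
- by congr existT; apply: val_inj => /=; rewrite -map_comp.
- by move=> d; apply: alpha_rename_update => // z fz; rewrite neq_ltn fresh_free.
- by move=> d; apply: alpha_rename_update => // z fz; rewrite neq_ltn fresh_free.
Qed.

Lemma alpha_update_rename (D : Type) (h : var -> D) N (g : var -> var) v w d phi :
  (forall z, free z phi -> g z != w) ->
  alpha (update h w d) (rename N (update g v w) phi) (update (h \o g) v d) phi.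
Proof.
by move=> gw; apply: alpha_rename_update => // h'; exact: alpha_rename.
Qed.

End Alpha.

(** * Soundness *)

Section Soundness.
Variables (S : signature) (F : frame) (M : model F S).
Implicit Types (phi psi : formula S) (x y z : point F) (g h : assignment F).

(** The clauses for [Neg], [Or] and [Ex] quantify over the points open to the current one, so the
    clause at the witness [x''] can be applied to [x'] itself; induction is left to [And] and
    [All]. *)
Lemma closure_forces g phi x : closure (forces M g phi) x -> forces M g phi x.
Proof.
elim: phi g x => [P vs|phi _|phi IH1 psi IH2|phi _ psi _|v phi IH|v phi _] g x /= c.
- exact/val_atom_closed.
- by move=> x' lt Hphi; have [x'' [lt' /(_ _ lt')]] := c _ lt.
- split; [apply: IH1 | apply: IH2] => x' lt;
    by have [x'' [lt' []]] := c _ lt; exists x''.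
- by move=> x' lt; have [x'' [lt' /(_ _ lt')]] := c _ lt.
- by move=> h vh; apply: IH => x' lt; have [x'' [lt' /(_ _ vh)]] := c _ lt; exists x''.
- by move=> x' lt; have [x'' [lt' /(_ _ lt')]] := c _ lt.
Qed.

Lemma forces_pre_refines g phi x y :
  pre_refines x y -> forces M g phi y -> forces M g phi x.
Proof. by move=> xy Hy; apply: closure_forces => z zx; exists y; split=> //; exact: xy. Qed.

Lemma variant_update g v d : variant v (update g v d) g.
Proof. by move=> w /eqP; rewrite /update => /negbTE ->. Qed.
Arguments variant_update : clear implicits.

(** A variant agrees with an [update] only pointwise; [alpha] bridges the two without function
    extensionality. *)
Lemma alpha_variant g h v phi : variant v h g -> alpha (update g v (h v)) phi h phi.
Proof.
move=> hg; apply: alpha_refl => w _; rewrite /update.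
by case: eqP => [->//|/hg].
Qed.

Lemma forces_alpha_iff g phi h psi x :
  alpha g phi h psi -> forces M g phi x <-> forces M h psi x.
Proof.
elim: phi g h psi x => [P vs|phi IH|phi1 IH1 phi2 IH2|phi1 IH1 phi2 IH2|v phi IH|v phi IH]
  g h [Q ws|psi|psi1 psi2|psi1 psi2|w psi|w psi] x //=.
- move=> e.
  (* Forcing of an atom is made a function of the whole dependent pair, so the equality of pairs
     rewrites without being split into components. *)
  pose f (s : {P : predicate S & (arity P).-tuple (individual F)}) :=
    val_atom M (projT2 s) x.
  by rewrite -[val_atom M (map_tuple h ws) x]/(f (existT _ Q (map_tuple h ws))) -e.
- by move=> a; split=> H x' /H; apply: contra_not; move/(IH _ _ _ _ a).
- by case=> /IH1 a1 /IH2 a2; rewrite a1 a2.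
- case=> /IH1 a1 /IH2 a2; split=> H x' /H [x'' [lt K]]; exists x''; split=> //.
    by case: K => [/a1|/a2]; [left|right].
  by case: K => [/a1|/a2]; [left|right].
- move=> a; split=> H k kh.
    have b := alpha_trans (a _) (alpha_variant psi kh).
    exact: (IH _ _ _ _ b).1 (H _ (variant_update g v (k w))).
  have b := alpha_trans (alpha_sym (alpha_variant phi kh)) (a _).
  exact: (IH _ _ _ _ b).2 (H _ (variant_update h w (k v))).
- move=> a; split=> H x' /H [x'' [lt [k [kg K]]]]; exists x''; split=> //.
    exists (update h w (k v)); split; first exact: variant_update.
    have b := alpha_trans (alpha_sym (alpha_variant phi kg)) (a _).
    exact: (IH _ _ _ _ b).1 K.
  exists (update g v (k w)); split; first exact: variant_update.
  have b := alpha_trans (a _) (alpha_variant psi kg).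
  exact: (IH _ _ _ _ b).2 K.
Qed.

Lemma forces_alpha g phi h psi x :
  alpha g phi h psi -> forces M g phi x -> forces M h psi x.
Proof. by move=> /forces_alpha_iff ->. Qed.

Lemma forces_not_free g h v phi x :
  ~~ free v phi -> variant v h g -> forces M g phi x -> forces M h phi x.
Proof.
move=> nf hg; apply: forces_alpha; apply: alpha_refl => w fw.
by rewrite hg // => wv; rewrite -wv fw in nf.
Qed.

End Soundness.

Section Derivability.
Variable S : signature.
Implicit Types (phi psi chi alpha : formula S) (s t : seq (entry S)) (u v w : var).

Lemma occurs_rcons e e' s : occurs e (rcons s e') <-> occurs e s \/ e = e'.
Proof. by rewrite /occurs -cats1 List.in_app_iff /=; intuition. Qed.

Lemma ends_with_occurs s phi : ends_with s phi -> occurs (Fm phi) s.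
Proof. by case=> r ->; apply/occurs_rcons; right. Qed.

Lemma begins_with_rcons s e phi : begins_with s phi -> begins_with (rcons s e) phi.
Proof. by case=> r ->; exists (rcons r e). Qed.

Lemma begins_with_occurs s phi : begins_with s phi -> occurs (Fm phi) s.
Proof. by case=> r ->; left. Qed.

Lemma begins_with_inj s phi psi : begins_with s phi -> begins_with s psi -> phi = psi.
Proof. by case=> r -> [r' [->]]. Qed.

Lemma proof_begins s : proof s -> exists phi, begins_with s phi.
Proof.
elim=> {s} [phi|||||||||||||]; first by exists phi, [::].
all: by move=> *; match goal with H : exists _, _ |- _ =>
  case: H => alpha H; exists alpha; exact: begins_with_rcons end.
Qed.

(** * Soundness of every entry of a proof *)

Definition sound_sequence s : Prop :=
  forall alpha beta, begins_with s alpha -> occurs (Fm beta) s ->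
  PRQ_entails alpha beta.

(** The rules discharging an assumption look into subproofs that are immediate entries of the
    sequence, so one level of nesting is an adequate invariant. *)
Definition hereditarily_sound s : Prop :=
  sound_sequence s /\ forall t, occurs (Sub t) s -> sound_sequence t.

Lemma hereditarily_sound_formula s phi :
  proof s -> hereditarily_sound s ->
  (forall alpha, begins_with s alpha -> PRQ_entails alpha phi) ->
  hereditarily_sound (rcons s (Fm phi)).
Proof.
move=> /proof_begins [alpha bs] [Hs Ht] Hphi; split; last first.
  by move=> t /occurs_rcons [/Ht|].
move=> alpha' beta /(begins_with_inj (begins_with_rcons _ bs)) <- /occurs_rcons.
by case=> [/Hs|[->]]; auto.
Qed.

Lemma proof_sound s : proof s -> hereditarily_sound s.
Proof.
elim=> {s}.
- move=> phi; split; last by move=> t [].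
  by move=> alpha beta [r [<- _]] [[<-] //|[]].
- move=> s t ps [Hs Hst] pt [Ht _]; split.
    have [alpha0 b0] := proof_begins ps.
    move=> alpha beta /(begins_with_inj (begins_with_rcons _ b0)) <-.
    by case/occurs_rcons=> // /Hs; apply.
  by move=> t' /occurs_rcons [/Hst|[->]].
- move=> s phi psi ps HS o1 o2; apply: hereditarily_sound_formula => // a ba.
  move=> F HF M g x Hx; split.
    exact: (HS.1 _ _ ba o1).
  exact: (HS.1 _ _ ba o2).
- move=> s phi psi ps HS o1; apply: hereditarily_sound_formula => // a ba.
  by move=> F HF M g x /(HS.1 _ _ ba o1 _ HF) [].
- move=> s phi psi ps HS o1; apply: hereditarily_sound_formula => // a ba.
  by move=> F HF M g x /(HS.1 _ _ ba o1 _ HF) [].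
- move=> s phi psi ps HS o1; apply: hereditarily_sound_formula => // a ba.
  move=> F HF M g x /(HS.1 _ _ ba o1 _ HF) H.
  by move=> x' lt; exists x; split=> //; left.
- move=> s phi psi ps HS o1; apply: hereditarily_sound_formula => // a ba.
  move=> F HF M g x /(HS.1 _ _ ba o1 _ HF) H.
  by move=> x' lt; exists x; split=> //; right.
- move=> s t1 t2 phi psi chi ps HS o [r rE] b1 e1 b2 e2.
  apply: hereditarily_sound_formula => // a ba.
  have E1 : PRQ_entails phi chi.
    apply: (HS.2 t1) b1 _; last exact: ends_with_occurs.
    by rewrite rE; apply/occurs_rcons; left; apply/occurs_rcons; right.
  have E2 : PRQ_entails psi chi.
    apply: (HS.2 t2) b2 _; last exact: ends_with_occurs.
    by rewrite rE; apply/occurs_rcons; right.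
  (* A disjunct holds only at some [x''] to which [x'] is open; closedness of the set forcing [chi]
     brings the conclusion back to [x]. *)
  move=> F HF M g x /(HS.1 _ _ ba o _ HF) H; apply: closure_forces => x' lt.
  have [x'' [lt' K]] := H _ lt; exists x''; split=> //.
  by case: K => [/(E1 _ HF)|/(E2 _ HF)].
- move=> s t phi psi ps HS o [r rE] bt et.
  apply: hereditarily_sound_formula => // a ba.
  have E : PRQ_entails phi (Neg psi).
    apply: (HS.2 t) bt _; last exact: ends_with_occurs.
    by rewrite rE; apply/occurs_rcons; right.
  move=> F HF M g x /(HS.1 _ _ ba o _ HF) Hpsi x' lt /(E _ HF) Hneg.
  (* Pseudosymmetry gives a point open to [x'] that inherits [psi] from [x], against [Neg psi] at
     [x']. *)
  have [z [zx' zx]] := HF.2 _ _ lt.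
  exact: Hneg zx' (forces_pre_refines zx Hpsi).
- move=> s phi psi ps HS o1 o2; apply: hereditarily_sound_formula => // a ba.
  (* Reflexivity evaluates the negation at [x] itself. *)
  move=> F HF M g x Hx; case: (HS.1 _ _ ba o2 _ HF _ _ _ Hx x (HF.1 x)).
  exact: (HS.1 _ _ ba o1).
- move=> s alpha phi v ps HS o bs nf; apply: hereditarily_sound_formula => // a ba.
  move=> F HF M g x Hx h hg; apply: (HS.1 _ _ bs o) => //.
  by apply: forces_not_free nf hg _; rewrite (begins_with_inj bs ba).
- move=> s phi v u ps HS o sub; apply: hereditarily_sound_formula => // a ba.
  move=> F HF M g x /(HS.1 _ _ ba o _ HF) H.
  apply: forces_alpha (alpha_sym (alpha_subst g sub)) _.
  exact: H _ (@variant_update _ _ _ _).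
- move=> s phi v u ps HS sub o; apply: hereditarily_sound_formula => // a ba.
  move=> F HF M g x /(HS.1 _ _ ba o _ HF) H x' lt; exists x; split=> //.
  exists (update g v (g u)); split; first exact: variant_update.
  exact: forces_alpha (alpha_subst g sub) H.
- move=> s t phi psi v ps HS o [r rE] bt et nf.
  apply: hereditarily_sound_formula => // a ba.
  have E : PRQ_entails phi psi.
    apply: (HS.2 t) bt _; last exact: ends_with_occurs.
    by rewrite rE; apply/occurs_rcons; right.
  move=> F HF M g x /(HS.1 _ _ ba o _ HF) H; apply: closure_forces => x' lt.
  have [x'' [lt' [h [hg /(E _ HF) K]]]] := H _ lt; exists x''; split=> //.
  by apply: forces_not_free nf _ K => w wv; rewrite hg.
Qed.

Theorem FQ_sound phi psi : FQ_derives phi psi -> PRQ_entails phi psi.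
Proof.
by case=> s [/proof_sound [H _] /H b /ends_with_occurs /b].
Qed.

(** * Derived rules *)

Notation "phi |-- psi" := (FQ_derives phi psi) (at level 70).

(* Disjunction elimination from [alpha \/ alpha] makes a cut out of two proofs
   that cannot be concatenated, as the eigenvariable condition of the
   universal introductions refers to the first entry of the sequence. *)
Lemma proof_cut s phi psi : proof s -> occurs (Fm phi) s -> phi |-- psi ->
  exists r, proof (rcons (s ++ r) (Fm psi)).
Proof.
move=> ps o [t [pt bt et]].
exists [:: Fm (Or phi phi); Sub t; Sub t].
have p1 := proof_orIl phi ps o.
have p2 := proof_sub (proof_sub p1 pt) pt.
have -> : s ++ [:: Fm (Or phi phi); Sub t; Sub t] =
  rcons (rcons (rcons s (Fm (Or phi phi))) (Sub t)) (Sub t).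
  by rewrite -!cats1 -!catA.
apply: (proof_orE p2 _ _ bt et bt et); last by exists (rcons s (Fm (Or phi phi))).
by rewrite /occurs -!cats1 !List.in_app_iff /=; tauto.
Qed.

Lemma derives_start alpha phi :
  proof [:: Fm alpha; Fm phi] -> alpha |-- phi.
Proof. by move=> p; exists [:: Fm alpha; Fm phi]; split=> //; [exists [:: Fm phi]|exists [:: Fm alpha]]. Qed.

Lemma derives_refl phi : phi |-- phi.
Proof. by exists [:: Fm phi]; split; [exact: proof_start|exists [::]|exists [::]]. Qed.

Lemma derives_trans psi phi chi : phi |-- psi -> psi |-- chi -> phi |-- chi.
Proof.
case=> s [ps bs es] d; have [r p] := proof_cut ps (ends_with_occurs es) d.
exists (rcons (s ++ r) (Fm chi)); split=> //; last by exists (s ++ r).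
by case: bs => q ->; rewrite rcons_cat; exists (q ++ rcons r (Fm chi)).
Qed.

(** Cutting the second derivation in at the first entry of the proof of [phi] brings both conjuncts
    into a single sequence. *)
Lemma derives_andI alpha phi psi :
  alpha |-- phi -> alpha |-- psi -> alpha |-- And phi psi.
Proof.
case=> s [ps bs es] d; have [r p] := proof_cut ps (begins_with_occurs bs) d.
exists (rcons (rcons (s ++ r) (Fm psi)) (Fm (And phi psi))); split.
- apply: proof_andI => //; apply/occurs_rcons; [left|by right].
  by apply: List.in_or_app; left; exact: ends_with_occurs.
- by case: bs => q ->; rewrite !rcons_cat; eexists.
- by eexists.
Qed.

Lemma derives_andEl phi psi : And phi psi |-- phi.
Proof. by apply/derives_start/(proof_andEl (psi := psi) (proof_start _)); left. Qed.

Lemma derives_andEr phi psi : And phi psi |-- psi.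
Proof. by apply/derives_start/(proof_andEr (phi := phi) (proof_start _)); left. Qed.

Lemma derives_orIl phi psi : phi |-- Or phi psi.
Proof. by apply/derives_start/(proof_orIl _ (proof_start _)); left. Qed.

Lemma derives_orIr phi psi : psi |-- Or phi psi.
Proof. by apply/derives_start/(proof_orIr _ (proof_start _)); left. Qed.

Lemma derives_orE phi psi chi : phi |-- chi -> psi |-- chi -> Or phi psi |-- chi.
Proof.
case=> t1 [p1 b1 e1] [t2 [p2 b2 e2]].
exists [:: Fm (Or phi psi); Sub t1; Sub t2; Fm chi]; split; last 2 first.
- by eexists.
- by exists [:: Fm (Or phi psi); Sub t1; Sub t2].
have p := proof_sub (proof_sub (proof_start (Or phi psi)) p1) p2.
by apply: (proof_orE p _ _ b1 e1 b2 e2); [left|exists [:: Fm (Or phi psi)]].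
Qed.

(** This is the symmetry of orthogonality; applied to [Neg psi |-- Neg psi] it gives double negation
    introduction. *)
Lemma derives_negI phi psi : phi |-- Neg psi -> psi |-- Neg phi.
Proof.
case=> t [pt bt et].
exists [:: Fm psi; Sub t; Fm (Neg phi)]; split; last 2 first.
- by eexists.
- by exists [:: Fm psi; Sub t].
apply: (proof_negI (proof_sub (proof_start psi) pt) _ _ bt et); first by left.
by exists [:: Fm psi].
Qed.

Lemma derives_negE alpha phi psi :
  alpha |-- phi -> alpha |-- Neg phi -> alpha |-- psi.
Proof.
move=> d1 d2; apply: derives_trans (derives_andI d1 d2) _.
exists [:: Fm (And phi (Neg phi)); Fm phi; Fm (Neg phi); Fm psi]; split; last 2 first.
- by eexists.
- by exists [:: Fm (And phi (Neg phi)); Fm phi; Fm (Neg phi)].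
have p1 : proof [:: Fm (And phi (Neg phi)); Fm phi].
  by apply: (proof_andEl (psi := Neg phi) (proof_start _)); left.
have p2 : proof [:: Fm (And phi (Neg phi)); Fm phi; Fm (Neg phi)].
  by apply: (proof_andEr (phi := phi) p1); left.
by apply: (proof_negE psi p2 (phi := phi)); rewrite /occurs /=; auto.
Qed.

Lemma derives_neg phi psi : phi |-- psi -> Neg psi |-- Neg phi.
Proof.
move=> d; apply: derives_negI; apply: derives_trans d _.
exact: derives_negI (derives_refl _).
Qed.

Lemma derives_allI alpha phi v : alpha |-- phi -> ~~ free v alpha -> alpha |-- All v phi.
Proof.
case=> s [ps bs es] nf; exists (rcons s (Fm (All v phi))); split.
- exact: proof_allI ps (ends_with_occurs es) bs nf.
- exact: begins_with_rcons.
- by eexists.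
Qed.

Lemma derives_allE phi v u : substitutable v u phi -> All v phi |-- subst v u phi.
Proof. by move=> sub; apply/derives_start/(proof_allE (proof_start _)) => //; left. Qed.

Lemma derives_exI phi v u : substitutable v u phi -> subst v u phi |-- Ex v phi.
Proof. by move=> sub; apply/derives_start/(proof_exI (proof_start _) sub); left. Qed.

Lemma derives_exE phi psi v : phi |-- psi -> ~~ free v psi -> Ex v phi |-- psi.
Proof.
case=> t [pt bt et] nf; exists [:: Fm (Ex v phi); Sub t; Fm psi]; split; last 2 first.
- by eexists.
- by exists [:: Fm (Ex v phi); Sub t].
apply: (proof_exE (proof_sub (proof_start (Ex v phi)) pt) _ _ bt et nf); first by left.
by exists [:: Fm (Ex v phi)].
Qed.

End Derivability.

(** * Completeness *)

Section Completeness.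
Variable S : signature.
Implicit Types (phi psi chi : formula S) (u v w : var).

Notation "phi |-- psi" := (FQ_derives phi psi) (at level 70).

(** * Interderivability of alpha-equivalent formulas *)

Lemma alpha_subst_subst v w u phi psi :
  substitutable v u phi -> substitutable w u psi ->
  (forall d, alpha (update id v d) phi (update id w d) psi) ->
  alpha id (subst v u phi) id (subst w u psi).
Proof.
move=> sv sw a; apply: alpha_trans (alpha_subst id sv) _.
exact: alpha_trans (a u) (alpha_sym (alpha_subst id sw)).
Qed.

(** Induction is on height because the quantifier cases call the hypothesis on instances of the
    bodies, which have the height of the bodies but are not subformulas. *)
Lemma alpha_derives phi psi : alpha id phi id psi -> phi |-- psi.
Proof.
have [n] := ubnP (height phi); elim: n => // n IH in phi psi *.
case: phi psi => [P vs|phi|phi1 phi2|phi1 phi2|v phi|v phi]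
  [Q ws|psi|psi1 psi2|psi1 psi2|w psi|w psi] //= lt a.
- have idE m (t : m.-tuple var) : map_tuple id t = t by apply: val_inj; exact: map_id.
  rewrite !idE in a.
  pose f (s : {P : predicate S & (arity P).-tuple var}) := Atom (projT2 s).
  rewrite -[Atom ws]/(f (existT _ Q ws)) -a; exact: derives_refl.
(* Negation reverses the direction, so the height bound must be moved from [phi] to [psi]. *)
- by apply: derives_neg; apply: IH (alpha_sym a); rewrite -(alpha_height a).
- move: lt a; rewrite ltnS gtn_max => /andP[l1 l2] [a1 a2]; apply: derives_andI.
    exact: derives_trans (derives_andEl _ _) (IH _ _ l1 a1).
  exact: derives_trans (derives_andEr _ _) (IH _ _ l2 a2).
- move: lt a; rewrite ltnS gtn_max => /andP[l1 l2] [a1 a2]; apply: derives_orE.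
    exact: derives_trans (IH _ _ l1 a1) (derives_orIl _ _).
  exact: derives_trans (IH _ _ l2 a2) (derives_orIr _ _).
(* Both quantified formulas are instantiated at a common variable [u], fresh for each. *)
- pose u := maxn (var_bound (All v phi)) (var_bound (All w psi)).
  have [bv bw] : var_bound (All v phi) <= u /\ var_bound (All w psi) <= u.
    by rewrite leq_maxl leq_maxr.
  have [fv fw] := (not_free_var_bound bv, not_free_var_bound bw).
  move: bv bw; rewrite /= !geq_max => /andP[vu bv] /andP[wu bw].
  have sv := var_bound_substitutable v bv; have sw := var_bound_substitutable w bw.
  have d : All v phi |-- All u (subst w u psi).
    apply: derives_allI fv; apply: derives_trans (derives_allE sv) _.
    by apply: IH; [rewrite height_subst|exact: alpha_subst_subst].
  apply: derives_trans d _.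
  (* Putting [w] back for [u] recovers [psi], which turns the binder [u] into [w]. *)
  have [su eu] := subst_fresh_inv w bw.
  apply: derives_allI; first by rewrite -{2}eu; exact: derives_allE.
  by rewrite /= negb_and not_free_subst ?orbT // neq_ltn wu.
- pose u := maxn (var_bound (Ex v phi)) (var_bound (Ex w psi)).
  have [bv bw] : var_bound (Ex v phi) <= u /\ var_bound (Ex w psi) <= u.
    by rewrite leq_maxl leq_maxr.
  have [fv fw] := (not_free_var_bound bv, not_free_var_bound bw).
  move: bv bw; rewrite /= !geq_max => /andP[vu bv] /andP[wu bw].
  have sv := var_bound_substitutable v bv; have sw := var_bound_substitutable w bw.
  (* Dually, the intermediate formula now comes from [phi], with binder [v] turned into [u]. *)
  have d : Ex u (subst v u phi) |-- Ex w psi.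
    apply: derives_exE fw; apply: derives_trans (derives_exI sw).
    by apply: IH; [rewrite height_subst|exact: alpha_subst_subst].
  apply: derives_trans d.
  have [su eu] := subst_fresh_inv v bv.
  apply: derives_exE; first by rewrite -{1}eu; exact: derives_exI.
  by rewrite /= negb_and not_free_subst ?orbT // neq_ltn vu.
Qed.

(** * Quantifiers as infima and suprema of renamed instances *)

Lemma alpha_rename_fresh N (g : var -> var) v u phi :
  (forall z, free z phi -> g z != u) ->
  forall d : var, alpha (update id u d) (rename N (update g v u) phi)
    (update id (fresh N g phi) d) (rename N (update g v (fresh N g phi)) phi).
Proof.
move=> gu d.
apply: alpha_trans (alpha_update_rename id N v d gu) _.
apply/alpha_sym/alpha_update_rename => z fz.
by rewrite neq_ltn fresh_free.
Qed.

Lemma alpha_subst_rename N N' (g : var -> var) v w u phi :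
  u <= N -> (forall z, free z phi -> g z != w) ->
  alpha (@id var) (subst w u (rename N (update g v w) phi)) id (rename N' (update g v u) phi).
Proof.
move=> uN gw; apply: alpha_trans (alpha_subst _ _) _; first exact: substitutable_rename.
apply: alpha_trans (alpha_update_rename id N v u gw) _.
exact/alpha_sym/alpha_rename.
Qed.

(** Both sides read as [phi] under [g], so the bound on binders can be changed at will. *)
Lemma rename_derives N N' g phi : rename N g phi |-- rename N' g phi.
Proof.
by apply: alpha_derives; apply: alpha_trans (alpha_rename _ _ _ _) (alpha_sym (alpha_rename _ _ _ _)).
Qed.

Lemma rename_All_derives N g v u phi :
  rename N g (All v phi) |-- rename N (update g v u) phi.
Proof.
(* Raising the bound to [u] pushes all binders beyond [u], so the instance at [u] is free of
   capture. *)
apply: derives_trans (rename_derives N u _ _) _.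
apply: derives_trans (derives_allE (substitutable_rename _ _ _ (leqnn u))) _.
apply: alpha_derives; apply: alpha_subst_rename => // z fz.
by rewrite neq_ltn fresh_free.
Qed.

Lemma rename_Ex_derives N g v u phi :
  rename N (update g v u) phi |-- rename N g (Ex v phi).
Proof.
apply: derives_trans (rename_derives u N _ _).
apply: derives_trans (derives_exI (substitutable_rename _ _ _ (leqnn u))).
apply: alpha_derives; apply: alpha_sym; apply: alpha_subst_rename => // z fz.
by rewrite neq_ltn fresh_free.
Qed.

Lemma derives_rename_All N g v phi psi :
  (forall u, psi |-- rename N (update g v u) phi) -> psi |-- rename N g (All v phi).
Proof.
(* This [u] meets the eigenvariable condition for [psi] and exceeds the values of [g] on the free
   variables of [phi], so binding it captures none of them. *)
move=> d; pose u := maxn (var_bound psi) (fresh 0 g phi).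
have nf : ~~ free u psi by apply: not_free_var_bound; exact: leq_maxl.
apply: (derives_trans (derives_allI (d u) nf)).
apply: alpha_derives => /= e; apply: alpha_rename_fresh => z fz.
by rewrite neq_ltn leq_max fresh_free ?orbT.
Qed.

Lemma derives_rename_Ex N g v phi psi :
  (forall u, rename N (update g v u) phi |-- psi) -> rename N g (Ex v phi) |-- psi.
Proof.
move=> d; pose u := maxn (var_bound psi) (fresh 0 g phi).
have nf : ~~ free u psi by apply: not_free_var_bound; exact: leq_maxl.
apply: (derives_trans _ (derives_exE (d u) nf)).
apply: alpha_derives; apply: alpha_sym => /= e; apply: alpha_rename_fresh => z fz.
by rewrite neq_ltn leq_max fresh_free ?orbT.
Qed.

(** * Points of the canonical frame *)

Record theory_point := TheoryPoint {
  asserted : formula S;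
  denied : formula S;
  asserted_not_denied : ~ asserted |-- denied;
  neg_asserted_denied : Neg asserted |-- denied }.

Definition theory_open (x y : theory_point) : Prop := ~ asserted y |-- denied x.

Lemma not_self_neg phi psi : ~ phi |-- psi -> ~ phi |-- Neg phi.
Proof. by move=> n d; apply: n; apply: derives_negE (derives_refl _) d. Qed.

(** Failing to derive some [psi] makes [phi] consistent, by explosion; a consistent formula is
    asserted by a point that denies its negation. *)
Definition neg_point phi psi (n : ~ phi |-- psi) : theory_point :=
  TheoryPoint (not_self_neg n) (derives_refl (Neg phi)).

(** Truth is not a primitive of the language, so it is built from whatever formula is at hand. *)
Definition verum phi : formula S := Neg (And phi (Neg phi)).

Lemma derives_verum phi psi : phi |-- verum psi.
Proof.
apply: derives_negI; apply: derives_negE.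
  exact: derives_andEl.
exact: derives_andEr.
Qed.

Lemma neg_verum_derives phi psi : Neg (verum phi) |-- psi.
Proof. exact: derives_negE (derives_verum _ _) (derives_refl _). Qed.

Lemma not_verum_derives phi psi chi : ~ phi |-- psi -> ~ verum chi |-- psi.
Proof. by move=> n d; apply: n; apply: derives_trans (derives_verum _ _) d. Qed.

Definition deny_point phi psi (n : ~ phi |-- psi) : theory_point :=
  TheoryPoint (not_verum_derives (chi := phi) n) (neg_verum_derives phi psi).

(* The refuting point below [x] is [(true, phi)]: whatever it is open to does
   not derive [phi]. *)
Lemma open_derives x phi :
  (forall x', theory_open x' x -> exists x'', theory_open x' x'' /\ asserted x'' |-- phi) ->
  asserted x |-- phi.
Proof.
move=> c; apply: NNPP => n.
by have [|x'' [/= n'' d]] := c (deny_point n).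
Qed.

(** The hypothesis serves twice: it makes [phi] consistent, hence asserted by a point, and it is the
    openness of [x'] to that point. *)
Lemma open_intro phi x' : ~ phi |-- denied x' ->
  exists x'', theory_open x' x'' /\ asserted x'' = phi.
Proof. by move=> n; exists (neg_point n). Qed.

Lemma derives_open phi x :
  asserted x |-- phi ->
  forall x', theory_open x' x -> exists x'', theory_open x' x'' /\ asserted x'' |-- phi.
Proof. by move=> d x' o; exists x. Qed.

(** * The canonical model and the truth lemma *)

Variable phi0 : formula S.
Hypothesis phi0_consistent : ~ phi0 |-- Neg phi0.

Definition theory_frame : frame :=
  @Frame theory_point theory_open var
    (inhabits (TheoryPoint phi0_consistent (derives_refl _))) (inhabits 0).

Lemma theory_frame_PRQ : PRQ theory_frame.
Proof.
split=> [x|x y /= o]; first exact: asserted_not_denied.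
(* Which points are open to a given one depends only on what it asserts, so a point asserting
   [asserted x] pre-refines [x]. *)
exists (neg_point o); split.
  move=> /= d; apply: o; apply: derives_trans (neg_asserted_denied y).
  exact: derives_negI.
by move=> z.
Qed.

Definition theory_val (P : predicate S) (d : (arity P).-tuple (individual theory_frame))
    (x : point theory_frame) : Prop :=
  asserted x |-- Atom d.

Lemma theory_val_closed (P : predicate S) (d : (arity P).-tuple (individual theory_frame)) x :
  closure (theory_val d) x <-> theory_val d x.
Proof. by split; [exact: open_derives|exact: derives_open]. Qed.

Definition theory_model : model theory_frame S := Model theory_val_closed.

Lemma theory_modelP g phi (x : point theory_frame) :
  forces theory_model g phi x <-> asserted x |-- rename 0 g phi.
Proof.
elim: phi g x => [P vs|phi IH|phi IH1 psi IH2|phi IH1 psi IH2|v phi IH|v phi IH] g x //=.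
- split=> [H|d x' o /IH d'].
    (* If the negation were not derived, the point asserting the renamed [phi] would be open to [x]
       and force [phi]. *)
    apply: NNPP => n.
    have n' : ~ rename 0 g phi |-- Neg (asserted x) by move/derives_negI.
    by apply: (H (neg_point n')) => //; apply/IH/derives_refl.
  apply: o; apply: derives_trans d _; apply: derives_trans (neg_asserted_denied x').
  exact: derives_neg.
- split=> [[/IH1 d1 /IH2 d2]|d]; first exact: derives_andI.
  by split; [apply/IH1|apply/IH2]; apply: derives_trans d _;
    [exact: derives_andEl|exact: derives_andEr].
- split=> [H|d x' o].
    apply: open_derives => x' /H [x'' [o K]]; exists x''; split=> //.
    case: K => [/IH1|/IH2] d; apply: derives_trans d _;
      [exact: derives_orIl|exact: derives_orIr].
  (* Some disjunct fails to derive [denied x'], since otherwise [asserted x] would derive it; the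
     point asserting that disjunct is the witness. *)
  have [d1|/open_intro [x'' [o' e]]] := classic (rename 0 g phi |-- denied x'); last first.
    by exists x''; split=> //; left; apply/IH1; rewrite e; exact: derives_refl.
  have [d2|/open_intro [x'' [o' e]]] := classic (rename 0 g psi |-- denied x'); last first.
    by exists x''; split=> //; right; apply/IH2; rewrite e; exact: derives_refl.
  by case: o; apply: derives_trans d _; exact: derives_orE.
- split=> [H|d h hg].
    by apply: derives_rename_All => u; apply/IH/H/variant_update.
  apply: forces_alpha (alpha_variant phi hg) _; apply/IH.
  exact: derives_trans d (rename_All_derives _ _ _ _ _).
- split=> [H|d x' o].
    apply: open_derives => x' /H [x'' [o [h [hg K]]]]; exists x''; split=> //.
    apply: derives_trans (rename_Ex_derives _ _ _ (h v) _); apply/IH.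
    exact: forces_alpha (alpha_sym (alpha_variant phi hg)) K.
  (* Were [denied x'] derived by every instance, it would be derived by their supremum, hence by
     [asserted x]. *)
  have [u n] : exists u, ~ rename 0 (update g v u) phi |-- denied x'.
    apply: not_all_ex_not => d'; apply: o; apply: derives_trans d _.
    exact: derives_rename_Ex.
  have [x'' [o' e]] := open_intro n; exists x''; split=> //.
  exists (update g v u); split; first exact: variant_update.
  by apply/IH; rewrite e; exact: derives_refl.
Qed.

End Completeness.

Theorem FQ_complete (S : signature) (phi psi : formula S) :
  PRQ_entails phi psi -> FQ_derives phi psi.
Proof.
move=> E; apply: NNPP => n.
(* Even under the identity, [rename] may change bound variables, so its result is only
   alpha-equivalent to [chi]. *)
have aid (chi : formula S) : alpha id (rename 0 id chi) id chi by exact: alpha_rename.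
pose x : point (theory_frame (not_self_neg n)) := neg_point n.
case: (n); apply: derives_trans (alpha_derives (aid psi)).
apply/(theory_modelP _ _ x)/E; first exact: theory_frame_PRQ.
exact/theory_modelP/alpha_derives/alpha_sym.
Qed.

Theorem theorem5p3 (S : signature) (phi psi : formula S) :
  FQ_derives phi psi <-> PRQ_entails phi psi.
Proof. by split; [exact: FQ_sound|exact: FQ_complete]. Qed.
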